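(* Let $(\mathcal{A},R)$ be a crystallographic arrangement in $V=\mathbb{R}^r$ and let $g$ be an involutive automorphism of $(\mathcal{A},R)$, i.e. $g\in \mathrm{GL}(V)$ with $g^2=\mathrm{id}$, $g.\mathcal{A}=\mathcal{A}$ and $g.R=R$. Let $X=V^{g}=\{v\in V\mid g.v=v\}$. Then the folding restriction $\mathcal{A}^{X}$ can be decomposed into two steps, a parabolic restriction followed by a permutation restriction. That is, there exist a subspace $X_1\in L(\mathcal{A})$ invariant under $g$, with $X\subseteq X_1$, and a chamber $K_2$ of the parabolic restriction $\mathcal{A}^{X_1}$ (with its restricted root system), such that $g|_{X_1}$ acts on the crystallographic arrangement $\mathcal{A}^{X_1}$ by a permutation action with respect to $K_2$ (i.e. $g$ permutes the set of simple roots at $K_2$), and the folding restriction $\mathcal{A}^{X}$ is the permutation restriction of $\mathcal{A}^{X_1}$ to the fixed space $X=(X_1)^{g}$.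
   Context: Arrangements. $V=\mathbb{R}^r$; for $\alpha\in V^*$ write $\alpha^\perp=\ker\alpha$. An arrangement $\mathcal{A}$ is a finite set of (linear) hyperplanes in $V$; its chambers are the connected components of $V\setminus\bigcup_{H\in\mathcal{A}}H$. It is simplicial if every chamber $K$ is an open simplicial cone $K=\{\sum_i a_i\alpha_i^\vee\mid a_i>0\}$ for some basis $\alpha_1^\vee,\dots,\alpha_r^\vee$ of $V$. Crystallographic arrangements. Let $\mathcal{A}$ be simplicial and let $R\subseteq V^*$ be a finite set with $\mathcal{A}=\{\alpha^\perp\mid\alpha\in R\}$ and $\mathbb{R}\alpha\cap R=\{\pm\alpha\}$ for all $\alpha\in R$. For a chamber $K$, let $\Delta^K=\{\alpha_1,\dots,\alpha_r\}\subseteq R$ be the set of simple roots at $K$: the normal vectors in $R$ of the walls of $K$ pointing to the inside, i.e. the basis dual to the suitably scaled generators $\alpha_i^\vee$ of $K$. The pair $(\mathcal{A},R)$ is crystallographic if $R\subseteq\sum_{\alpha\in\Delta^K}\mathbb{Z}\alpha$ for every chamber $K$. Restrictions. $L(\mathcal{A})$ is the set of all intersections of elements of $\mathcal{A}$ (including $V$ itself as the empty intersection). For a subspace $X\le V$, the restriction of $\mathcal{A}$ to $X$ is the arrangement in $X$ given by $\mathcal{A}^X=\{X\cap H\mid H\in\mathcal{A},\ X\not\subseteq H\}$. It is called a parabolic restriction if $X\in L(\mathcal{A})$. In that case it is again crystallographic. Its restricted root system is obtained as follows: choose a chamber $K$ of $\mathcal{A}$ and a subset $J\subseteq\Delta^K$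 with $X=J^\perp=\bigcap_{\alpha\in J}\alpha^\perp$. For each $\beta=\sum_{\alpha\in\Delta^K}b_\alpha\alpha\in R$ not in the span of $J$, delete the coordinates $b_\alpha$ with $\alpha\in J$, and divide the resulting integer vector by the greatest common divisor of its entries. The vectors so obtained are viewed as linear forms on $X$ with respect to the basis $(\alpha|_X)_{\alpha\in\Delta^K\setminus J}$. Actions. A group $G$ acts on $(\mathcal{A},R)$ if it acts linearly on $V$ with $g.\mathcal{A}=\mathcal{A}$ and $g.R=R$ for all $g\in G$, where $(g.\alpha)(v)=\alpha(g^{-1}.v)$ for $\alpha\in V^*$. The folding restriction is the restriction $\mathcal{A}^{X}$ to the space $X=V^G$ of fixed points. If there is a chamber $K$ such that $G$ permutes the simple roots $\Delta^K$, the action is called a permutation action (with respect to $K$), and the corresponding folding restriction is called a permutation restriction. *)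

(* Defs.v *)
From HB Require Import structures.
From mathcomp Require Import all_boot all_order all_algebra.
From mathcomp Require Import all_classical all_reals all_analysis.
Import Order.TTheory GRing.Theory Num.Theory.
Import numFieldNormedType.Exports.
Set Implicit Arguments.
Unset Strict Implicit.
Unset Printing Implicit Defensive.
Local Open Scope classical_set_scope.
Local Open Scope ring_scope.

(* V is an arbitrary finite-dimensional real space, so that a restriction to X is
   again an arrangement, in the space [subvs_of X]. *)

Section Arrangements.
Variables (R : realType) (V : vectType R).
Implicit Types (A : set {vspace V}) (Phi : set 'Hom(V, R^o)) (K : set V).

Definition arrangement A :=
  finite_set A /\ forall H, A H -> (\dim H).+1 = \dim {:V}.

Definition complement A : set V := [set v | forall H, A H -> v \notin H].

(* A [vectType] carries no topology; V gets that of R^n through coordinates in a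
   basis, and any two bases give the same topology. *)
Definition coordinates : V -> 'rV[R]_(\dim {:V}) := passmx.rVof (vbasis {:V}).

Definition chamber A K :=
  exists2 x, complement A x &
    coordinates @` K
    = connected_component (coordinates @` complement A) (coordinates x).

Definition open_cone n (b : n.-tuple V) : set V :=
  [set v | exists2 a : 'I_n -> R, (forall i, 0 < a i)
                                & v = \sum_(i < n) a i *: tnth b i].

Definition generators K (b : (\dim {:V}).-tuple V) :=
  basis_of {:V} b /\ K = open_cone b.

Definition simplicial A :=
  arrangement A /\ forall K, chamber A K -> exists b, generators K b.

Definition root_set A Phi :=
  [/\ finite_set Phi,
      A = [set lker alpha | alpha in Phi] &
      forall alpha, Phi alpha ->
        [set c *: alpha | c in [set: R]] `&` Phi = [set alpha; - alpha]].

(* The forms in Phi that belong to the basis dual to some choice of generators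
   of K: the kernel of such an alpha is spanned by all generators but one, and
   alpha is positive on the remaining one. *)
Definition simple_roots Phi K : set 'Hom(V, R^o) :=
  [set alpha | Phi alpha /\
    exists b i, generators K b /\ forall j, alpha (tnth b j) = (i == j)%:R].

Definition integer_span (D : set 'Hom(V, R^o)) : set 'Hom(V, R^o) :=
  [set beta | exists b : 'Hom(V, R^o) -> int,
                beta = \sum_(alpha \in D) alpha *~ b alpha].

Definition real_span (D : set 'Hom(V, R^o)) : set 'Hom(V, R^o) :=
  [set beta | exists c : 'Hom(V, R^o) -> R,
                beta = \sum_(alpha \in D) c alpha *: alpha].

Definition crystallographic A Phi :=
  [/\ simplicial A, root_set A Phi &
      forall K, chamber A K -> Phi `<=` integer_span (simple_roots Phi K)].

Definition intersection_lattice A : set {vspace V} :=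
  [set X | exists2 s : seq {vspace V},
             [set` s] `<=` A & X = (\bigcap_(H <- s) H)%VS].

Definition form_action (g : 'End(V)) (alpha : 'Hom(V, R^o)) : 'Hom(V, R^o) :=
  (alpha \o g^-1)%VF.

(* Action of the cyclic group generated by g. *)
Definition arrangement_action (g : 'End(V)) A Phi :=
  [/\ lker g = 0%VS,
      [set (g @: H)%VS | H in A] = A &
      [set form_action g alpha | alpha in Phi] = Phi].

Definition permutation_action (g : 'End(V)) A Phi K :=
  [/\ chamber A K, arrangement_action g A Phi &
      [set form_action g alpha | alpha in simple_roots Phi K]
      = simple_roots Phi K].

End Arrangements.

Section Restrictions.
Variables (R : realType) (V : vectType R).
Implicit Types (A : set {vspace V}) (Phi : set 'Hom(V, R^o)) (X : {vspace V}).

Definition inclusion X : 'Hom(subvs_of X, V) := linfun vsval.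

Definition restriction A X : set {vspace subvs_of X} :=
  [set (inclusion X @^-1: H)%VS | H in [set H | A H /\ ~~ (X <= H)%VS]].

Definition restrict_form X (alpha : 'Hom(V, R^o)) : 'Hom(subvs_of X, R^o) :=
  (alpha \o inclusion X)%VF.

(* The restriction of g to X, when g maps X to itself. *)
Definition restrict_end (g : 'End(V)) X : 'End(subvs_of X) :=
  (linfun (vsproj X) \o (g \o inclusion X))%VF.

Definition restricted_roots Phi X (D J : set 'Hom(V, R^o)) :
    set 'Hom(subvs_of X, R^o) :=
  [set gamma | exists beta (b : 'Hom(V, R^o) -> int),
    let d := \big[gcdn/0%N]_(alpha \in D `\` J) `|b alpha|%N in
    [/\ Phi beta, ~ real_span J beta,
        beta = \sum_(alpha \in D) alpha *~ b alpha &
        gamma = \sum_(alpha \in D `\` J)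
                   restrict_form X alpha *~ (b alpha %/ d%:Z)%Z]].

(* The set on the right of the last equation does not depend on K and J. *)
Definition restricted_root_system A Phi X (PhiX : set 'Hom(subvs_of X, R^o)) :=
  exists K (J : set 'Hom(V, R^o)),
    [/\ chamber A K, J `<=` simple_roots Phi K,
        [set` X] = [set v | forall alpha, J alpha -> alpha v = 0] &
        PhiX = restricted_roots (X := X) Phi (simple_roots Phi K) J].

(* The hyperplanes of an arrangement in X, seen as subspaces of V. *)
Definition in_ambient X (B : set {vspace subvs_of X}) : set {vspace V} :=
  [set (inclusion X @: H)%VS | H in B].

End Restrictions.

Arguments restriction {R V} A X _.
Arguments restricted_roots {R V} Phi X D J _.
Arguments restricted_root_system {R V} A Phi X PhiX.

(* Main.v *)
Require Import Defs.
From HB Require Import structures.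
From mathcomp Require Import all_boot all_order all_algebra.
From mathcomp Require Import all_classical all_reals all_analysis.
From mathcomp Require Import ring.
Import Order.TTheory GRing.Theory Num.Theory.
Import numFieldNormedType.Exports.
Set Implicit Arguments.
Unset Strict Implicit.
Unset Printing Implicit Defensive.
Local Open Scope classical_set_scope.
Local Open Scope ring_scope.

(** Let X1 be the intersection of the hyperplanes of A that contain X = V^g.
    Since g fixes X pointwise, it permutes those hyperplanes, and X1 is
    g-invariant.  A hyperplane of A that does not contain X1 does not contain X
    either, and X is not a finite union of proper subspaces; so X contains a
    point x off every hyperplane of the restriction to X1
    ([relative_generic_vector]).  The chamber of x in that restriction is mapped
    to itself, because x is fixed, and hence its simple roots are permuted
    ([fixed_chamber_permutation]).

    Two facts about the restriction to X1 are needed: that it is crystallographic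
    with its restricted root system, and that g preserves this root system,
    although the latter is defined through the choice of a chamber.  Both come
    from a description of the restricted roots that involves no choice: they are
    the primitive vectors of the lattice generated by the restrictions to X1 of
    the roots, among the real multiples of these restrictions
    ([parabolic_roots], [restricted_rootsE]).

    For the first fact, let x be any point of X1 off the hyperplanes of the
    restriction, and move it slightly into a chamber K of A
    ([adjacent_chamber]).  A root is a combination of the simple roots at K with
    coefficients of one sign, so a root that vanishes at x involves only the
    simple roots that vanish at x.  Therefore X1 is the common kernel of these,
    and the remaining simple roots restrict to a basis that cuts out the chamber
    of x in X1 ([face_simple_system]).  Every chamber of the restriction arises
    in this way, and the restricted lattice is spanned by each of these bases
    ([parabolic_crystallographic]).

    Simplicial cones are handled through pairs of dual families of forms and
    generators, indexed by an arbitrary finite type ([simple_system]), so that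
    deleting some simple roots does not require renumbering the others. *)

(** * Chambers as sets of constant sign *)

Section Chambers.
Variables (R : realType) (V : vectType R).
Implicit Types (A : set {vspace V}) (Phi : set 'Hom(V, R^o)) (K : set V).
Implicit Types (alpha beta : 'Hom(V, R^o)) (v x : V).

(** When no form of [Phi] vanishes at [x], the chamber of [x]
    ([component_same_side]). *)
Definition same_side Phi x : set V :=
  [set v | forall alpha, Phi alpha -> 0 < alpha v * alpha x].

Local Notation coordinates := (@coordinates R V).
Let vec := passmx.vecof (F := R) (vbasis {:V}).

Lemma coordinatesK : cancel coordinates vec.
Proof. exact: passmx.rVofK (vbasisP _). Qed.

Lemma vecK : cancel vec coordinates.
Proof. exact: passmx.vecofK (vbasisP _). Qed.

Lemma form_continuous alpha :
  continuous (fun u : 'rV[R]_(\dim {:V}) => alpha (vec u) : R).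
Proof.
have -> : (fun u : 'rV[R]_(\dim {:V}) => alpha (vec u) : R) =
    fun u => \sum_i u 0 i * (alpha (vbasis {:V})`_i : R).
  apply/funext => u; rewrite /vec /passmx.vecof linear_sum.
  by apply: eq_bigr => i _; rewrite linearZ.
apply: continuous_big => [|i _ u]; first exact: add_continuous.
exact: (cvgMr_tmp (FF := nbhs_filter u) (@coord_continuous R 1 _ 0 i u)).
Qed.

(** The values of [alpha] on a connected set form an interval; when it misses 0,
    all values have the same sign. *)
Lemma form_sign_connected alpha (B : set 'rV[R]_(\dim {:V})) u w :
  connected B -> (forall z, B z -> alpha (vec z) != 0) -> B u -> B w ->
  0 < alpha (vec u) * alpha (vec w).
Proof.
move=> Bc B0 Bu Bw.
have /connected_intervalP itv :
    connected ((fun z => alpha (vec z) : R) @` B).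
  apply: connected_continuous_connected => //.
  by apply: continuous_subspaceT => z; exact: form_continuous.
have nz a b : B a -> B b -> alpha (vec a) <= (0 : R) <= alpha (vec b) -> False.
  move=> Ba Bb ab.
  have [z Bz /eqP z0] : ((fun z => alpha (vec z) : R) @` B) 0.
    by apply: (itv (alpha (vec a)) (alpha (vec b))) => //;
      [exists a|exists b].
  by move: z0; rewrite (negbTE (B0 _ Bz)).
have := B0 _ Bu; rewrite neq_lt => /orP[] u0;
  have := B0 _ Bw; rewrite neq_lt => /orP[] w0.
- by rewrite nmulr_rgt0.
- by case: (nz u w Bu Bw); rewrite !ltW.
- by case: (nz w u Bw Bu); rewrite !ltW.
- by rewrite mulr_gt0.
Qed.

Lemma same_side_star_shaped Phi x v (t : R) :
  (forall alpha, Phi alpha -> alpha x != 0) -> same_side Phi x v ->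
  0 <= t <= 1 -> same_side Phi x (x + t *: (v - x)).
Proof.
move=> x0 xv /andP[t0 t1] alpha Pa.
have := xv _ Pa; have := x0 _ Pa.
rewrite linearD linearZ linearB /=; set a : R := alpha x; set b : R := alpha v.
rewrite /GRing.scale/= => a0 ba.
have -> : (a + t * (b - a)) * a = t * (b * a) + (1 - t) * (a * a).
  by rewrite mulrDl -mulrA !mulrBl mul1r mulrBr addrCA.
move: t0; rewrite le_eqVlt => /orP[/eqP <-|t0].
  by rewrite mul0r add0r subr0 mul1r -expr2 exprn_even_gt0.
apply: ltr_wpDr; last exact: mulr_gt0.
by apply: mulr_ge0; rewrite ?subr_ge0// -expr2 sqr_ge0.
Qed.

Lemma complementE A Phi : A = [set lker alpha | alpha in Phi] ->
  complement A = [set v | forall alpha, Phi alpha -> alpha v != 0].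
Proof.
move=> ->; apply/seteqP; split => v /= cv.
  by move=> alpha Pa; rewrite -memv_ker; apply: cv; exists alpha.
by move=> _ [alpha Pa <-]; rewrite memv_ker; exact: cv.
Qed.

(** The right-hand side contains the component because no form changes sign on a
    connected subset of the complement, and it is contained in the component
    because it is star-shaped around [x]. *)
Lemma component_same_side A Phi x : A = [set lker alpha | alpha in Phi] ->
  complement A x ->
  connected_component (coordinates @` complement A) (coordinates x)
  = coordinates @` same_side Phi x.
Proof.
move=> defA; rewrite (complementE defA) => cx.
apply/seteqP; split => [u [B [Bx BC Bc] Bu]|_ [v xv <-]].
  exists (vec u); last exact: vecK.
  move=> alpha Pa; rewrite -(coordinatesK x).
  apply: (form_sign_connected Bc) => // z /BC [w cw <-].
  by rewrite coordinatesK; exact: cw.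
pose p (t : R) := coordinates (x + t *: (v - x)).
exists (p @` `[0, 1]).
  split.
  - by exists 0; [rewrite /= in_itv/= lexx ler01|rewrite /p scale0r addr0].
  - move=> w [t]; rewrite /= in_itv/= => t01 <-; exists (x + t *: (v - x)) => //.
    move=> alpha Pa; apply: contraTneq (same_side_star_shaped cx xv t01 Pa) => ->.
    by rewrite mul0r ltxx.
  apply: connected_continuous_connected; first exact: segment_connected.
  apply: continuous_subspaceT => t.
  rewrite /p (_ : (fun _ => _) =
    fun t : R => coordinates x + t *: coordinates (v - x)); last first.
    apply/funext => s; rewrite [x + _]addrC [RHS]addrC.
    exact: passmx.rVof_linear.
  by apply: cvgD; [exact: cvg_cst|apply: cvgZr_tmp; exact: cvg_id].
exists 1; first by rewrite /= in_itv/= lexx ler01.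
by rewrite /p scale1r addrC subrK.
Qed.

Lemma chamberP A Phi K : A = [set lker alpha | alpha in Phi] ->
  chamber A K <->
  exists2 x, (forall alpha, Phi alpha -> alpha x != 0) & K = same_side Phi x.
Proof.
move=> defA; have cA := complementE defA.
split=> [[x cx]|[x cx ->]].
  rewrite (component_same_side defA cx) => KE; exists x; first by rewrite cA in cx.
  have inj := can_inj coordinatesK.
  by apply/funext => v; rewrite -(image_inj (A := K) inj) KE (image_inj inj).
by exists x; rewrite ?(component_same_side defA)// cA.
Qed.

End Chambers.

(** * Simplicial cones and dual families *)

Section DualFamilies.
Variables (R : realType) (V : vectType R).
Implicit Types (A : set {vspace V}) (Phi : set 'Hom(V, R^o)) (K : set V).
Implicit Types (alpha beta : 'Hom(V, R^o)) (v x : V).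

Definition dual_families (I : finType) (f : I -> 'Hom(V, R^o)) (e : I -> V) :=
  (forall i j, f i (e j) = (i == j)%:R) /\
  (forall v, (forall i, f i v = 0) -> v = 0).

Definition positive_cone (I : finType) (f : I -> 'Hom(V, R^o)) : set V :=
  [set v | forall i, 0 < f i v].

Section OnePair.
Variables (I : finType) (f : I -> 'Hom(V, R^o)) (e : I -> V).
Hypothesis fe : dual_families f e.

Lemma sum_dual i (c : I -> R) : f i (\sum_j c j *: e j) = c i.
Proof.
rewrite linear_sum (bigD1 i)//= linearZ /= fe.1 eqxx big1 ?addr0.
  by rewrite /GRing.scale/= mulr1.
by move=> j ji; rewrite linearZ /= fe.1 eq_sym (negbTE ji) scaler0.
Qed.

Lemma vector_expand v : v = \sum_i (f i v : R) *: e i.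
Proof.
apply/eqP; rewrite -subr_eq0; apply/eqP/fe.2 => i.
by rewrite linearB /= sum_dual subrr.
Qed.

Lemma form_expand alpha : alpha = \sum_i (alpha (e i) : R) *: f i.
Proof.
apply/lfunP => v; rewrite sum_lfunE {1}[v]vector_expand linear_sum.
by apply: eq_bigr => i _; rewrite linearZ scale_lfunE /GRing.scale/= mulrC.
Qed.

Lemma dual_inj : injective f.
Proof.
move=> i j fij; apply/eqP; have := fe.1 j i; rewrite -fij fe.1 eqxx eq_sym.
by case: eqP => // _ /eqP; rewrite oner_eq0.
Qed.

Lemma dual_neq0 i : f i != 0.
Proof.
apply/eqP => f0; have := fe.1 i i; rewrite f0 zero_lfunE eqxx.
by move/esym/eqP; rewrite oner_eq0.
Qed.

Lemma dual_basis n (h : 'I_n -> I) : bijective h ->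
  basis_of {:V} [tuple e (h i) | i < n].
Proof.
move=> bh; move tE: [tuple e (h i) | i < n] => t.
have tnE (j : 'I_n) : t`_j = e (h j) by rewrite -tnth_nth -tE tnth_mktuple.
have [h' hK h'K] := bh.
rewrite basisEfree subvf /=; apply/andP; split.
  apply/freeP => k + i.
  under eq_bigr => j _ do rewrite tnE.
  rewrite (reindex h') /=; last by exists h => j _; rewrite ?hK ?h'K.
  under eq_bigr => j _ do rewrite h'K.
  move/(congr1 (f (h i))); rewrite linear0 (sum_dual _ (fun j => k (h' j))).
  by rewrite hK.
suff -> : {:V}%VS = <<t>>%VS by exact: dim_span.
apply/eqP; rewrite eqEsubv subvf andbT; apply/subvP => v _.
rewrite [v]vector_expand memv_suml// => i _; apply/memvZ/memv_span.
by rewrite -[i]h'K -tnE mem_nth// size_tuple.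
Qed.

Lemma exists_indexing : exists h : 'I_(\dim {:V}) -> I, bijective h.
Proof.
have bij : bijective (@enum_val I predT) by exact: enum_val_bij.
have := size_basis (dual_basis bij); move=> ->; by exists enum_val.
Qed.

Lemma open_cone_dual n (h : 'I_n -> I) : bijective h ->
  open_cone [tuple e (h i) | i < n] = positive_cone f.
Proof.
move=> [h' hK h'K]; apply/seteqP; split => [v [a a0 ->] i|v v0].
  under eq_bigr => j _ do rewrite tnth_mktuple.
  rewrite (reindex h') /=; last by exists h => j _; rewrite ?hK ?h'K.
  by under eq_bigr => j _ do rewrite h'K; rewrite (sum_dual _ (a \o h')) /=.
exists (fun i => f (h i) v); first by move=> i; exact: v0.
rewrite {1}[v]vector_expand (reindex h) /=; last first.
  by exists h' => j _; rewrite ?hK ?h'K.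
by apply: eq_bigr => i _; rewrite tnth_mktuple.
Qed.

Lemma generators_positive_cone : exists (b : (\dim {:V}).-tuple V)
    (h : 'I_(\dim {:V}) -> I),
  [/\ generators (positive_cone f) b, bijective h &
      forall j, tnth b j = e (h j)].
Proof.
have [h bh] := exists_indexing.
exists [tuple e (h i) | i < _], h; split => //; last first.
  by move=> j; rewrite tnth_mktuple.
by split; [exact: dual_basis|rewrite open_cone_dual].
Qed.

Lemma positive_cone_nonempty : positive_cone f (\sum_i e i).
Proof.
move=> i; under eq_bigr => j _ do rewrite -[e j]scale1r.
by rewrite (sum_dual _ (fun=> 1)) ltr01.
Qed.

(** Moving [v] along the interior point [\sum_i e i] would reach a zero of
    [alpha] inside the open cone if [alpha v] were negative. *)
Lemma closed_cone_ge0 alpha v : (forall w, positive_cone f w -> 0 < alpha w) ->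
  (forall i, 0 <= f i v) -> 0 <= alpha v.
Proof.
move=> pos v0; have := positive_cone_nonempty; set w := \sum_i e i => w0.
rewrite leNgt; apply/negP => av.
have aw := pos _ w0.
have : 0 < alpha (v + (- (alpha v : R) / alpha w) *: w).
  apply: pos => i; rewrite linearD linearZ /=; apply: ltr_wpDl => //.
  by apply: mulr_gt0 => //; apply: divr_gt0 => //; rewrite oppr_gt0.
rewrite linearD linearZ /= /GRing.scale /= divfK ?gt_eqF//.
by rewrite subrr ltxx.
Qed.

End OnePair.

Lemma generators_dual K (b : (\dim {:V}).-tuple V) : generators K b ->
  exists2 f : 'I_(\dim {:V}) -> 'Hom(V, R^o),
    dual_families f (tnth b) & K = positive_cone f.
Proof.
move=> [bb ->].
have fb := basis_free bb.
pose f i : 'Hom(V, R^o) := linfun (coord b i : V -> R^o).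
have fe : dual_families f (tnth b).
  split=> [i j|v v0].
    by rewrite lfunE /= (tnth_nth 0) coord_free// eq_sym.
  rewrite (coord_basis bb (memvf v)) big1// => i _.
  by have := v0 i; rewrite lfunE /= => ->; rewrite scale0r.
exists f => //.
have bij : bijective (id : 'I_(\dim {:V}) -> _) by exists id.
rewrite -(open_cone_dual fe bij); congr open_cone.
by apply: eq_from_tnth => i; rewrite tnth_mktuple.
Qed.

(** A cone determines its facets, hence the forms that cut it out up to positive
    scaling.  The coordinates of each family in the other basis are nonnegative.
    Choose [i] such that [e i] lies off the facet of [f' j].  For [k != j], the
    point [e' k] lies on that facet, so its [i]-th coordinate vanishes: thus
    [f i] kills every [e' k] but [e' j], and is a multiple of [f' j]. *)
Lemma facets_unique (I J : finType) (f : I -> 'Hom(V, R^o)) e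
    (f' : J -> 'Hom(V, R^o)) e' :
  dual_families f e -> dual_families f' e' ->
  positive_cone f = positive_cone f' ->
  forall j, exists i, exists2 c : R, 0 < c & f' j = c *: f i.
Proof.
move=> fe fe' ff' j.
have f'e_ge0 k i : 0 <= f' k (e i).
  apply: (closed_cone_ge0 fe) => [w|l]; first by rewrite ff'; apply.
  by rewrite fe.1 ler0n.
have fe'_ge0 i k : 0 <= f i (e' k).
  apply: (closed_cone_ge0 fe') => [w|l]; first by rewrite -ff'; apply.
  by rewrite fe'.1 ler0n.
have [i fi] : exists i, f' j (e i) != 0.
  apply/existsP; apply: contraT; rewrite negb_exists => /forallP z.
  have := dual_neq0 fe' j; rewrite [f' j](form_expand fe) big1 ?eqxx// => i _.
  by have := z i; rewrite negbK => /eqP ->; rewrite scale0r.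
have fi0 : 0 < f' j (e i) by rewrite lt0r fi f'e_ge0.
have E : f i = (f i (e' j) : R) *: f' j.
  rewrite {1}[f i](form_expand fe') (bigD1 j)//= big1 ?addr0// => k kj.
  have := fe'.1 j k; rewrite eq_sym (negbTE kj).
  rewrite {1}[e' k](vector_expand fe) linear_sum => /eqP.
  rewrite psumr_eq0 => [/allP/(_ i (mem_index_enum _))|l _]; last first.
    by rewrite linearZ; apply: mulr_ge0; [exact: fe'_ge0|exact: f'e_ge0].
  rewrite linearZ /= mulf_eq0 (negbTE fi) orbF => /eqP ->.
  by rewrite scale0r.
have c0 : f i (e' j) != 0 :> R.
  by apply: contraTneq (dual_neq0 fe i) => z; rewrite E z scale0r eqxx.
exists i, (f i (e' j) : R)^-1.
  by rewrite invr_gt0 lt0r c0 fe'_ge0.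
exact: (canRL (scalerK c0) (esym E)).
Qed.

End DualFamilies.

(** * Perturbation and simple roots *)

Section SimpleSystems.
Variables (R : realType) (V : vectType R).
Implicit Types (A : set {vspace V}) (Phi : set 'Hom(V, R^o)) (K : set V).
Implicit Types (alpha beta : 'Hom(V, R^o)) (v x : V).

Lemma perturbation (s : seq 'Hom(V, R^o)) x y :
  exists2 eps : R, 0 < eps &
    {in s, forall alpha, alpha x != 0 -> 0 < alpha (x + eps *: y) * alpha x}.
Proof.
suff [eps eps0 H] : exists2 eps : R, 0 < eps & forall t, 0 < t <= eps ->
    {in s, forall alpha, alpha x != 0 -> 0 < alpha (x + t *: y) * alpha x}.
  by exists eps => //; apply: H; rewrite eps0 lexx.
elim: s => [|alpha s [eps eps0 IH]]; first by exists 1.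
(* The value of [alpha] at [x + t *: y] keeps its sign as long as
   [t * `|alpha y| < `|alpha x|]; adding 1 avoids a zero denominator. *)
pose d : R := `|alpha x : R| / (`|alpha y : R| + 1).
have [x0|x0] := eqVneq (alpha x) 0.
  exists eps => // t te beta; rewrite inE => /predU1P[->|]; last exact: IH.
  by rewrite x0 eqxx.
have d0 : 0 < d by rewrite divr_gt0 ?normr_gt0// ltr_wpDl.
exists (Num.min eps d); first by rewrite lt_min eps0.
move=> t /andP[t0]; rewrite le_min => /andP[te td] beta.
rewrite inE => /predU1P[-> _|]; last by apply: IH; rewrite t0.
rewrite linearD linearZ /=; set a : R := alpha x; set b : R := alpha y.
rewrite /GRing.scale /=.
have a0 : 0 < `|a| by rewrite normr_gt0.
have tb : t * `|b| < `|a|.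
  have : t * (`|b| + 1) <= `|a| by rewrite -ler_pdivlMr// ltr_wpDl.
  by apply: lt_le_trans; rewrite ltr_pM2l// ltrDl.
have : 0 < (`|a| - t * `|b|) * `|a| by rewrite mulr_gt0// subr_gt0.
move=> /lt_le_trans; apply; rewrite mulrBl mulrDl -normrM -expr2 normrX.
rewrite real_normK ?num_real// expr2 lerD2l -!mulrA -normrM -mulrN.
by rewrite ler_pM2l// lerNl -normrN ler_norm.
Qed.

(** Two perturbations: adding small vectors one after the other produces a point
    of [X] that is no zero of any form in [s]; a small multiple of that point is
    then added to [x]. *)
Lemma generic_vector (X : {vspace V}) (s : seq 'Hom(V, R^o)) x : x \in X ->
  {in s, forall alpha, exists2 y, y \in X & alpha y != 0} ->
  exists2 y, y \in X & {in s, forall alpha,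
    alpha y != 0 /\ (alpha x != 0 -> 0 < alpha y * alpha x)}.
Proof.
move=> xX nz.
have [y yX y0] : exists2 y, y \in X & {in s, forall alpha, alpha y != 0}.
  elim: s nz => [|alpha s IH] nz; first by exists 0; rewrite ?mem0v.
  have [|y yX y0] := IH; first by move=> b bs; apply: nz; rewrite inE bs orbT.
  have [z zX z0] := nz alpha (mem_head _ _).
  have [eps eps0 H] := perturbation (alpha :: s) y z.
  exists (y + eps *: z); first by rewrite memvD ?memvZ.
  move=> beta bs; have [yb|yb] := eqVneq (beta y) 0; last first.
    by have := H _ bs yb; apply: contraTneq => ->; rewrite mul0r ltxx.
  move: bs; rewrite inE => /predU1P[E|/y0]; last by rewrite yb eqxx.
  rewrite linearD linearZ /= yb add0r E mulf_neq0// ?gt_eqF//.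
have [eps eps0 H] := perturbation s x y.
exists (x + eps *: y); first by rewrite memvD ?memvZ.
move=> alpha sa; split; last exact: H.
have [x0|x0] := eqVneq (alpha x) 0.
  by rewrite linearD linearZ /= x0 add0r mulf_neq0 ?y0// gt_eqF.
by have := H _ sa x0; apply: contraTneq => ->; rewrite mul0r ltxx.
Qed.

Lemma kernel_hyperplane alpha :
  ((\dim (lker alpha)).+1 = \dim {:V}) <-> alpha != 0.
Proof.
have := limg_ker_dim alpha fullv; rewrite capfv => <-.
have [->|a0] := eqVneq alpha 0.
  have -> : ((0 : 'Hom(V, R^o)) @: {:V} = 0)%VS.
    apply/eqP; rewrite -lkerE; apply/subvP => v _.
    by rewrite memv_ker zero_lfunE.
  by rewrite dimv0 addn0; split => // /eqP; rewrite eqn_leq ltnn.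
suff -> : limg alpha = fullv by rewrite dimvf /dim /= addn1.
apply/eqP; rewrite eqEdim subvf dimvf /dim /= lt0n dimv_eq0 -lkerE.
apply: contra a0 => /subvP k; apply/eqP/lfunP => v.
by apply/eqP; rewrite zero_lfunE -memv_ker k ?memvf.
Qed.

Lemma root_opp A Phi alpha : root_set A Phi -> Phi alpha -> Phi (- alpha).
Proof.
move=> [_ _ H] Pa; have : [set alpha; - alpha] (- alpha) by right.
by rewrite -(H _ Pa) => -[].
Qed.

Lemma root_proportional A Phi alpha (c : R) : root_set A Phi -> Phi alpha ->
  Phi (c *: alpha) -> c *: alpha = alpha \/ c *: alpha = - alpha.
Proof.
move=> [_ _ H] Pa Pc.
have : [set alpha; - alpha] (c *: alpha) by rewrite -(H _ Pa); split => //; exists c.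
by [].
Qed.

Lemma root_neq0 A Phi alpha : arrangement A -> root_set A Phi -> Phi alpha ->
  alpha != 0.
Proof.
by move=> [_ hA] [_ defA _] Pa; apply/kernel_hyperplane/hA; rewrite defA; exists alpha.
Qed.

(** A chamber [K] together with its simple roots [f] and its generators [e]. *)
Definition simple_system (I : finType) Phi K (f : I -> 'Hom(V, R^o)) e :=
  [/\ dual_families f e, forall i, Phi (f i) & K = positive_cone f].

(** Every generating tuple of [K] gives the same simple roots: its dual forms are
    positive multiples of the [f i] by [facets_unique], and [Phi] contains only
    one positive multiple of each root. *)
Lemma simple_rootsE A Phi K (I : finType) (f : I -> 'Hom(V, R^o)) e :
  root_set A Phi -> simple_system Phi K f e -> simple_roots Phi K = range f.
Proof.
move=> rs [fe Pf KE]; apply/seteqP; split => [alpha|_ [i _ <-]]; last first.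
  split => //; have [b [h [gb [h' hK h'K] bh]]] := generators_positive_cone fe.
  exists b, (h' i); rewrite KE; split => // j.
  by rewrite bh fe.1 -{1}(h'K i) (inj_eq (can_inj hK)).
move=> [Pa [b [i [gb ab]]]].
have [f' fe' KE'] := generators_dual gb.
have aE : alpha = f' i.
  rewrite [alpha](form_expand fe') (bigD1 i)//= ab eqxx scale1r big1 ?addr0//.
  by move=> j ji; rewrite ab eq_sym (negbTE ji) scale0r.
have [j [c c0]] := facets_unique fe fe' (etrans (esym KE) KE') i.
rewrite -aE => E; exists j => //; move: Pa; rewrite E => Pa.
have [//|/(congr1 (fun a : 'Hom(V, R^o) => a (e j)))] :=
  root_proportional rs (Pf j) Pa.
rewrite scale_lfunE opp_lfunE fe.1 eqxx /GRing.scale /= mulr1 => c1.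
by move: c0; rewrite c1 oppr_gt0 ltr10.
Qed.

(** The coordinates of a root in the simple roots of a chamber all have the sign
    that the root has on the chamber. *)
Lemma generator_root_ge0 Phi (I : finType) (f : I -> 'Hom(V, R^o)) e x beta i :
  dual_families f e -> same_side Phi x = positive_cone f -> Phi beta ->
  0 <= beta (e i) * beta x.
Proof.
move=> fe KE Pb.
have := @closed_cone_ge0 _ _ _ f e fe ((beta x : R) *: beta) (e i).
rewrite scale_lfunE mulrC; apply => [w|j]; last by rewrite fe.1 ler0n.
by rewrite -KE => /(_ _ Pb); rewrite scale_lfunE mulrC.
Qed.

(** Each wall of [K] is the kernel of a root.  Otherwise no root vanishes at the
    sum [p] of all generators but one: the values of a root at the generators
    have one sign, so it vanishes at [p] only if it is a multiple of the form of
    the wall.  Then [p] would lie in the open cone, although it is on the wall. *)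
Lemma chamber_simple_system A Phi K : simplicial A -> root_set A Phi ->
  chamber A K ->
  exists (f : 'I_(\dim {:V}) -> 'Hom(V, R^o)) e, simple_system Phi K f e.
Proof.
move=> [arr simA] rs ch.
have [b gb] := simA K ch; have [f0 fe KE0] := generators_dual gb.
have [_ defA _] := rs.
have [x x0 KE] := (chamberP _ defA).1 ch.
have KEE : same_side Phi x = positive_cone f0 by rewrite -KE -KE0.
have wall i : exists c : R, 0 < c /\ Phi (c *: f0 i).
  apply: contrapT => no.
  pose p := \sum_j (j != i)%:R *: tnth b j.
  have : positive_cone f0 p.
    rewrite -KEE => alpha Pa.
    have ge0 j : 0 <= alpha (tnth b j) * alpha x.
      exact: (generator_root_ge0 j fe KEE Pa).
    have [j /andP[ji aj]|all0] := pickP (fun j => (j != i) && (alpha (tnth b j) != 0)).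
      rewrite linear_sum mulr_suml (bigD1 j)//= ji scale1r.
      apply: ltr_wpDr; last by rewrite lt0r ge0 mulf_neq0 ?x0.
      apply: sumr_ge0 => k _; rewrite linearZ /= /GRing.scale /= -mulrA.
      by apply: mulr_ge0 => //; rewrite ler0n.
    have aE : alpha = (alpha (tnth b i) : R) *: f0 i.
      rewrite {1}[alpha](form_expand fe) (bigD1 i)//= big1 ?addr0// => j ji.
      by have := all0 j; rewrite ji /= => /negbFE/eqP ->; rewrite scale0r.
    have := root_neq0 arr rs Pa; have := Pa; rewrite aE scaler_eq0 negb_or.
    move=> Pc /andP[c0 _]; exfalso; apply: no.
    move: c0; rewrite neq_lt => /orP[c0|c0]; last by eexists; split; eauto.
    exists (- alpha (tnth b i)); rewrite oppr_gt0 scaleNr; split => //.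
    exact: root_opp rs Pc.
  move/(_ i); rewrite (sum_dual fe i (fun j => (j != i)%:R)) eqxx.
  by rewrite ltxx.
have /choice [c cP] := wall.
exists (fun i => c i *: f0 i), (fun i => (c i)^-1 *: tnth b i).
have c0 i : c i != 0 by rewrite gt_eqF// (cP i).1.
split => [|i|]; last 2 first.
- exact: (cP i).2.
- rewrite KE0; apply/seteqP; split => v v0 i; have := v0 i;
    by rewrite scale_lfunE /GRing.scale /= pmulr_rgt0 ?(cP i).1.
split=> [i j|v v0].
  rewrite scale_lfunE linearZ /= fe.1 /GRing.scale /=.
  by case: eqP => [->|_]; rewrite ?mulr0// mulr1 mulfV.
apply: fe.2 => i; have := v0 i; rewrite scale_lfunE => /eqP.
by rewrite mulf_eq0 (negbTE (c0 i)) => /eqP.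
Qed.

End SimpleSystems.

(** * Primitive vectors of a lattice *)

Section Lattices.
Variable U : zmodType.
Implicit Types S L : set U.

Inductive generated_group S : set U :=
| generated_mem a of S a : generated_group S a
| generated0 : generated_group S 0
| generatedB a b of generated_group S a & generated_group S b :
    generated_group S (a - b).

Lemma generatedN S a : generated_group S a -> generated_group S (- a).
Proof. by rewrite -sub0r; apply: generatedB; exact: generated0. Qed.

Lemma generatedD S a b :
  generated_group S a -> generated_group S b -> generated_group S (a + b).
Proof. by move=> Sa Sb; rewrite -[b]opprK; apply/generatedB/generatedN. Qed.

Lemma generatedMz S a (n : int) :
  generated_group S a -> generated_group S (a *~ n).
Proof.
move=> Sa; have nat_case k : generated_group S (a *+ k).
  by elim: k => [|k IH]; [exact: generated0|rewrite mulrS; exact: generatedD].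
by case: n => k; [exact: nat_case|exact/generatedN/nat_case].
Qed.

Lemma generated_sum S (I : Type) (s : seq I) (P : pred I) (F : I -> U) :
  (forall i, P i -> generated_group S (F i)) ->
  generated_group S (\sum_(i <- s | P i) F i).
Proof.
by move=> SF; apply: big_ind SF; [exact: generated0|exact: generatedD].
Qed.

Definition primitive L gamma :=
  L gamma /\ forall delta (n : int), L delta -> gamma = delta *~ n -> `|n|%N = 1%N.

Lemma primitiveN S gamma :
  primitive (generated_group S) gamma -> primitive (generated_group S) (- gamma).
Proof.
move=> [Sg H]; split=> [|d n Sd /eqP]; first exact: generatedN.
by rewrite eqr_oppLR -mulNrz => /eqP /H; apply; exact: generatedN.
Qed.

Lemma primitive_neq0 S gamma : primitive (generated_group S) gamma -> gamma != 0.
Proof.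
move=> [_ H]; apply/eqP => g0.
by have := H 0 0 (generated0 S); rewrite mulr0z => /(_ g0).
Qed.

End Lattices.

Lemma lfun_mulzE (R : realType) (V W : vectType R) (h : 'Hom(V, W)) (n : int) v :
  (h *~ n) v = h v *~ n.
Proof. by rewrite -scaler_int scale_lfunE scaler_int. Qed.

Section PrimitiveForms.
Variables (R : realType) (V : vectType R).
Implicit Types (A : set {vspace V}) (Phi S : set 'Hom(V, R^o)) (K : set V).
Implicit Types (alpha beta gamma : 'Hom(V, R^o)) (v x : V).

(** For a set [S] of forms, the primitive vectors of its lattice on the lines
    spanned by its elements: the restricted root system when [S] consists of the
    restrictions of the roots. *)
Definition primitive_multiples S : set 'Hom(V, R^o) :=
  [set gamma | primitive (generated_group S) gamma /\
    exists beta (c : R), S beta /\ gamma = c *: beta].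

Definition integer_combinations (I : finType) (f : I -> 'Hom(V, R^o)) :
    set 'Hom(V, R^o) :=
  [set beta | exists m : I -> int, beta = \sum_i f i *~ m i].

Section Basis.
Variables (I : finType) (f : I -> 'Hom(V, R^o)) (e : I -> V).
Hypothesis fe : dual_families f e.

Lemma combination_coord (m : I -> int) j :
  (\sum_i f i *~ m i) (e j) = (m j)%:~R :> R.
Proof.
rewrite sum_lfunE (bigD1 j)//= lfun_mulzE fe.1 eqxx big1 ?addr0// => i ij.
by rewrite lfun_mulzE fe.1 (negbTE ij) mul0rz.
Qed.

Lemma combination_inj (m n : I -> int) :
  \sum_i f i *~ m i = \sum_i f i *~ n i -> m =1 n.
Proof.
move=> E i; apply/eqP; rewrite -(eqr_int R) -!combination_coord.
by rewrite E.
Qed.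

Lemma combinationMz (m : I -> int) (n : int) :
  (\sum_i f i *~ m i) *~ n = \sum_i f i *~ (m i * n).
Proof. by rewrite mulrz_suml; apply: eq_bigr => i _; rewrite mulrzA. Qed.

Variable S : set 'Hom(V, R^o).
Hypothesis Sf : forall i, S (f i).
Hypothesis S_comb : S `<=` integer_combinations f.

Lemma generated_combinations : generated_group S = integer_combinations f.
Proof.
apply/seteqP; split => [beta|_ [m ->]]; last first.
  by apply: generated_sum => i _; apply/generatedMz/generated_mem.
elim => [a /S_comb //||a b _ [m ->] _ [n ->]].
  by exists (fun=> 0); rewrite big1.
by exists (fun i => m i - n i); rewrite -sumrB; apply: eq_bigr => i _; rewrite mulrzBr.
Qed.

(** If the reduced vector is [n] times a lattice vector, then [n * d] divides all
    the coordinates [m i], hence their gcd [d]. *)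
Lemma primitive_gcd (m : I -> int) (d := \big[gcdn/0%N]_i `|m i|%N) :
  (exists i, m i != 0) ->
  [/\ d != 0%N,
      primitive (generated_group S) (\sum_i f i *~ (m i %/ d)%Z) &
      \sum_i f i *~ m i = (d%:R : R) *: \sum_i f i *~ (m i %/ d)%Z].
Proof.
move=> [i0 mi0].
have dm i : (d %| m i)%Z by rewrite /dvdz /=; exact: biggcdn_inf.
have d0 : d != 0%N.
  by apply: contraNneq mi0 => d0; have := dm i0; rewrite d0 dvd0z.
split => //; last first.
  rewrite -[d%:R]/(d%:~R) scaler_int combinationMz.
  by apply: eq_bigr => i _; rewrite divzK.
rewrite generated_combinations; split=> [|_ n [k ->]].
  by exists (fun i => (m i %/ d)%Z).
rewrite combinationMz => /combination_inj mk.
have : (`|n|%N * d %| d)%N.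
  apply/dvdn_biggcdP => i _.
  have -> : `|m i|%N = (`|k i| * (`|n| * d))%N.
    by rewrite -{1}(divzK (dm i)) mk !abszM mulnA.
  exact: dvdn_mull.
rewrite -{2}[d]mul1n dvdn_pmul2r ?lt0n// dvdn1.
by move/eqP.
Qed.

Lemma primitive_basis i : primitive (generated_group S) (f i).
Proof.
rewrite generated_combinations.
have fE : f i = \sum_j f j *~ (i == j)%:Z.
  rewrite (bigD1 i)//= eqxx mulr1z big1 ?addr0// => j ij.
  by rewrite eq_sym (negbTE ij) mulr0z.
split=> [|_ n [m ->]]; first by eexists; exact: fE.
rewrite fE combinationMz => /combination_inj/(_ i); rewrite eqxx.
move/(congr1 absz); rewrite abszM => /esym/eqP.
by rewrite muln_eq1 => /andP[_ /eqP].
Qed.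

(** Proportional integer vectors have a rational ratio [p / q] in lowest terms.
    Then [q] divides every coordinate of the first vector and [p] every
    coordinate of the second, so both are 1 or -1 by primitivity. *)
Lemma primitive_proportional gamma (c : R) :
  primitive (generated_group S) gamma ->
  primitive (generated_group S) (c *: gamma) ->
  c *: gamma = gamma \/ c *: gamma = - gamma.
Proof.
move=> pg pc; have g0 := primitive_neq0 pg.
move: pg pc g0; rewrite generated_combinations => -[[n ->]] pn [[m E]] pm g0.
have cnm j : c * (n j)%:~R = (m j)%:~R :> R.
  by rewrite -!combination_coord -E scale_lfunE.
have [i ni] : exists i, n i != 0.
  apply/existsP; apply: contraNT g0; rewrite negb_exists => /forallP z.
  by rewrite big1// => i _; have := z i; rewrite negbK => /eqP ->; rewrite mulr0z.
pose d := gcdz (m i) (n i).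
have d0 : d != 0 by rewrite gcdz_eq0 negb_and ni orbT.
pose p := (m i %/ d)%Z; pose q := (n i %/ d)%Z.
have mE : m i = p * d by rewrite divzK ?dvdz_gcdl.
have nE : n i = q * d by rewrite divzK ?dvdz_gcdr.
have copq : coprimez q p.
  rewrite coprimez_sym /coprimez; apply/eqP/(mulIf d0).
  by rewrite mul1r -[LHS]/(gcdz p q * `|d|%N) mulz_gcdl -mE -nE.
have pq j : m j * q = n j * p.
  apply: (mulIf d0); rewrite -!mulrA -mE -nE; apply/eqP.
  rewrite -(eqr_int R) !rmorphM /= -!cnm.
  by rewrite [_ * (c * _)]mulrCA mulrA.
have q1 : `|q|%N = 1%N.
  apply: (pn (\sum_j f j *~ (n j %/ q)%Z)); first by eexists.
  rewrite combinationMz; apply: eq_bigr => j _; rewrite divzK//.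
  by rewrite -(Gauss_dvdzl _ copq) -pq dvdz_mull.
have copp : coprimez p q by rewrite coprimez_sym.
have p1 : `|p|%N = 1%N.
  apply: (pm (\sum_j f j *~ (m j %/ p)%Z)); first by eexists.
  rewrite E combinationMz; apply: eq_bigr => j _; rewrite divzK//.
  by rewrite -(Gauss_dvdzl _ copp) pq dvdz_mull.
have cq : c * q%:~R = p%:~R :> R.
  have dR : d%:~R != 0 :> R by rewrite intr_eq0.
  by apply: (mulIf dR); rewrite -mulrA -!rmorphM /= -mE -nE.
have c1 : c = 1 \/ c = -1.
  have abs1 (k : int) : `|k|%N = 1%N -> `|k%:~R : R| = 1.
    by move=> k1; rewrite -intr_norm -abszE k1.
  have := congr1 (fun a : R => `|a|) cq.
  rewrite normrM (abs1 _ q1) (abs1 _ p1) mulr1 => /eqP.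
  by rewrite eqr_norml ler01 andbT => /orP[] /eqP; [left|right].
by case: c1 => ->; [left; rewrite scale1r|right; rewrite scaleN1r].
Qed.

End Basis.
End PrimitiveForms.

(** * The root system of primitive multiples *)

Section FiniteSums.
Variables (T : Type) (idx : T) (op : Monoid.com_law idx).
Variables (I : finType) (J : choiceType) (f : I -> J).
Hypothesis f_inj : injective f.

Lemma fsbig_image_finType (Q : {set I}) (F : J -> T) :
  \big[op/idx]_(j \in f @` [set` Q]) F j = \big[op/idx]_(i in Q) F (f i).
Proof.
rewrite fsbig_image; last by move=> i j _ _; apply: f_inj.
by rewrite (bigfs _ (index_enum_uniq I))// => i _; rewrite mem_index_enum.
Qed.

Lemma fsbig_range (F : J -> T) :
  \big[op/idx]_(j \in range f) F j = \big[op/idx]_i F (f i).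
Proof.
transitivity (\big[op/idx]_(i in [set: I]%SET) F (f i)).
  rewrite -(fsbig_image_finType _ F); apply: eq_fsbigl; congr (_ @` _).
  by apply/seteqP; split => i //= _; rewrite inE.
by apply: eq_bigl => i; rewrite inE.
Qed.

End FiniteSums.

Section PrimitiveRootSystem.
Variables (R : realType) (V : vectType R).
Implicit Types (A : set {vspace V}) (Phi S : set 'Hom(V, R^o)) (K : set V).
Implicit Types (alpha beta gamma : 'Hom(V, R^o)) (v x : V).

Lemma integer_span_range (I : finType) (f : I -> 'Hom(V, R^o)) : injective f ->
  integer_span (range f) = integer_combinations f.
Proof.
move=> fi; apply/seteqP; split => [_ [b ->]|_ [m ->]].
  by rewrite fsbig_range//; exists (b \o f).
exists (fun alpha => odflt 0 (omap m [pick i | f i == alpha])).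
rewrite fsbig_range//; apply: eq_bigr => i _.
by case: pickP => [j /eqP/fi ->//|/(_ i)]; rewrite eqxx.
Qed.

Lemma lker_scale alpha (c : R) : c != 0 -> lker (c *: alpha) = lker alpha.
Proof.
move=> c0; apply/vspaceP => v.
by rewrite !memv_ker scale_lfunE scaler_eq0 (negbTE c0).
Qed.

Section Basis.
Variables (I : finType) (f : I -> 'Hom(V, R^o)) (e : I -> V).
Hypothesis fe : dual_families f e.
Variable S : set 'Hom(V, R^o).
Hypothesis Sf : forall i, S (f i).
Hypothesis S_comb : S `<=` integer_combinations f.

Lemma primitive_multiples_basis i : primitive_multiples S (f i).
Proof.
split; first exact: (primitive_basis fe Sf S_comb).
by exists (f i), 1; rewrite scale1r.
Qed.

Lemma exists_primitive_multiple beta : S beta -> beta != 0 ->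
  exists (c : R) gamma, [/\ c != 0, primitive_multiples S gamma & gamma = c *: beta].
Proof.
move=> Sb b0; have [m bE] := S_comb Sb.
have [|d0 pg E] := primitive_gcd fe Sf S_comb (m := m).
  apply/existsP; apply: contraNT b0; rewrite negb_exists => /forallP z.
  by rewrite bE big1// => i _; have := z i; rewrite negbK => /eqP ->; rewrite mulr0z.
move: d0 pg E; rewrite -bE; set d := \big[gcdn/0%N]_i _; set g := \sum_i _ => d0 pg E.
have dR : (d%:R : R) != 0 by rewrite pnatr_eq0.
exists d%:R^-1, g; split; first by rewrite invr_eq0.
  split=> //; exists beta, d%:R^-1; split=> //.
  exact: (canRL (scalerK dR) (esym E)).
exact: (canRL (scalerK dR) (esym E)).
Qed.

Lemma primitive_multiple_unique beta (a b : R) :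
  primitive_multiples S (a *: beta) -> primitive_multiples S (b *: beta) ->
  b *: beta = a *: beta \/ b *: beta = - (a *: beta).
Proof.
move=> [pa _] [pb _].
have a0 : a != 0.
  by apply: contraNneq (primitive_neq0 pa) => ->; rewrite scale0r.
have E : b *: beta = (b / a) *: (a *: beta) by rewrite scalerA divfK.
by rewrite E in pb *; apply: (primitive_proportional fe Sf S_comb).
Qed.

(** By [primitive_multiple_unique] each element of [S] contributes at most two
    primitive multiples. *)
Lemma primitive_multiples_finite : finite_set S -> finite_set (primitive_multiples S).
Proof.
move=> fS.
have sub : primitive_multiples S `<=`
  \bigcup_(beta in S) (primitive_multiples S `&` [set c *: beta | c in [set: R]]).
  by move=> gamma pg; have [_ [beta [c [Sb E]]]] := pg; exists beta => //; split => //; exists c.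
apply: sub_finite_set sub _; apply: bigcup_finite => // beta Sb.
have [[a pa]|none] := pselect (exists a : R, primitive_multiples S (a *: beta)).
  apply: (@sub_finite_set _ _ [set a *: beta; - (a *: beta)]); last exact: finite_set2.
  move=> gamma [pb [b _ E]]; rewrite -{}E in pb *.
  exact: primitive_multiple_unique pa pb.
apply: (@sub_finite_set _ _ set0) => // gamma [pb [b _ E]]; apply: none; exists b.
by rewrite E.
Qed.

Lemma primitive_multiples_root_set : finite_set S ->
  root_set [set lker alpha | alpha in S `&` [set alpha | alpha != 0]]
    (primitive_multiples S).
Proof.
move=> fS; split; first exact: primitive_multiples_finite.
  apply/seteqP; split=> [_ [beta [Sb b0] <-]|_ [gamma pg <-]].
    have [c [gamma [c0 pg E]]] := exists_primitive_multiple Sb b0.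
    by exists gamma => //; rewrite E lker_scale.
  have [pp [beta [c [Sb E]]]] := pg; have := primitive_neq0 pp.
  rewrite E scaler_eq0 negb_or => /andP[c0 b0].
  by exists beta => //; rewrite lker_scale.
move=> alpha pa; apply/seteqP; split=> [_ [[c _ <-] pc]|_ [->|->]].
- by apply: (primitive_proportional fe Sf S_comb); [case: pa|case: pc].
- by split => //; exists 1; rewrite ?scale1r.
split; first by exists (-1); rewrite ?scaleN1r.
have [pp [beta [c [Sb E]]]] := pa; split; first exact: primitiveN.
by exists beta, (- c); rewrite scaleNr -E.
Qed.

End Basis.

(** The reason why an automorphism acts on a restricted root system: the
    definition of primitive multiples refers to [S] only. *)
Lemma primitive_multiples_comp S (phi : 'End(V)) :
  (phi \o phi)%VF = \1%VF -> (forall alpha, S alpha -> S (alpha \o phi)%VF) ->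
  forall alpha, primitive_multiples S alpha ->
    primitive_multiples S (alpha \o phi)%VF.
Proof.
move=> phi2 Sphi.
have gen alpha : generated_group S alpha -> generated_group S (alpha \o phi)%VF.
  elim=> [a Sa||a b _ IHa _ IHb].
  - exact/generated_mem/Sphi.
  - by rewrite comp_lfun0l; exact: generated0.
  - by rewrite comp_lfunDl comp_lfunNl; exact: generatedB.
have compK alpha : ((alpha \o phi) \o phi)%VF = alpha.
  by rewrite -comp_lfunA phi2 comp_lfun1r.
move=> alpha [[ga pa] [beta [c [Sb E]]]]; split; last first.
  by exists (beta \o phi)%VF, c; rewrite E comp_lfunZl; split => //; exact: Sphi.
split=> [|delta n Sd E']; first exact: gen.
apply: (pa (delta \o phi)%VF); first exact: gen.
rewrite -[alpha]compK E'; apply/lfunP => v.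
by rewrite comp_lfunE !lfun_mulzE comp_lfunE.
Qed.

End PrimitiveRootSystem.

(** * Restricting forms and roots to a subspace *)

Section RestrictedForms.
Variables (R : realType) (V : vectType R) (X : {vspace V}).
Implicit Types (A : set {vspace V}) (Phi : set 'Hom(V, R^o)) (K : set V).
Implicit Types (alpha beta : 'Hom(V, R^o)).

Lemma inclusionE (v : subvs_of X) : inclusion X v = vsval v.
Proof. by rewrite lfunE. Qed.

Lemma restrict_formE alpha (v : subvs_of X) :
  restrict_form X alpha v = alpha (vsval v).
Proof. by rewrite comp_lfunE inclusionE. Qed.

Lemma restrict_form_eq0 alpha :
  (restrict_form X alpha == 0) = (X <= lker alpha)%VS.
Proof.
apply/eqP/subvP => [r0 v vX|sub].
  by rewrite memv_ker -(vsprojK vX) -restrict_formE r0 zero_lfunE.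
apply/lfunP => v; rewrite restrict_formE zero_lfunE.
by apply/eqP; rewrite -memv_ker sub// subvsP.
Qed.

Lemma preim_lker alpha :
  (inclusion X @^-1: lker alpha)%VS = lker (restrict_form X alpha).
Proof.
by apply/vspaceP => v; rewrite memv_ker restrict_formE -memv_preim memv_ker inclusionE.
Qed.

Lemma restriction_kernels A Phi : A = [set lker alpha | alpha in Phi] ->
  restriction A X = [set lker alpha | alpha in
    (restrict_form X @` Phi) `&` [set alpha | alpha != 0]].
Proof.
move=> ->; apply/seteqP; split => [_ [_ [[alpha Pa <-] nX] <-]|].
  exists (restrict_form X alpha); last by rewrite preim_lker.
  by split; [exists alpha|rewrite /= restrict_form_eq0].
move=> H [_ [[alpha Pa <-] /= nX] <-]; rewrite restrict_form_eq0 in nX.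
by exists (lker alpha); [split => //; exists alpha|rewrite preim_lker].
Qed.

(** Here [Q] indexes the simple roots that survive the restriction: X is the
    common kernel of the others. *)
Section Coordinates.
Variables (I : finType) (f : I -> 'Hom(V, R^o)) (e : I -> V) (Q : {set I}).
Hypothesis fe : dual_families f e.
Hypothesis XE : forall v, v \in X <-> forall i, i \notin Q -> f i v = 0.

Definition restricted_basis (x : {i : I | i \in Q}) := restrict_form X (f (val x)).
Definition restricted_dual (x : {i : I | i \in Q}) := vsproj X (e (val x)).

Lemma restricted_dualK x : vsval (restricted_dual x) = e (val x).
Proof.
rewrite vsprojK//; apply/XE => i iQ; rewrite fe.1.
by case: eqP => // ix; move: iQ; rewrite ix (valP x).
Qed.

Lemma restrict_dual_families : dual_families restricted_basis restricted_dual.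
Proof.
split=> [x y|v v0].
  by rewrite restrict_formE restricted_dualK fe.1.
apply/subvs_inj; rewrite linear0; apply: fe.2 => i.
have [iQ|iQ] := boolP (i \in Q); last exact: (XE _).1 (subvsP v) _ iQ.
by have := v0 (Sub i iQ); rewrite restrict_formE.
Qed.

Lemma restrict_combination (m : I -> int) :
  restrict_form X (\sum_i f i *~ m i) = \sum_x restricted_basis x *~ m (val x).
Proof.
rewrite -(big_sub Q (fun i => restrict_form X (f i) *~ m i)).
apply/lfunP => v; rewrite restrict_formE !sum_lfunE [LHS](bigID (mem Q)) /=.
rewrite [X in _ + X]big1 ?addr0 => [|i iQ].
  by apply: eq_bigr => i _; rewrite !lfun_mulzE restrict_formE.
by rewrite lfun_mulzE ((XE _).1 (subvsP v))// mul0rz.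
Qed.

Variable Phi : set 'Hom(V, R^o).
Hypothesis Phi_f : forall i, Phi (f i).
Hypothesis Phi_comb : Phi `<=` integer_combinations f.

Let S := restrict_form X @` Phi.

Lemma restricted_basis_mem x : S (restricted_basis x).
Proof. by exists (f (val x)). Qed.

Lemma restrict_combinations : S `<=` integer_combinations restricted_basis.
Proof.
move=> _ [beta /Phi_comb [m ->] <-]; rewrite restrict_combination.
by exists (m \o val).
Qed.

(** Deleting the coordinates outside [Q] expresses the restriction of a root in
    the basis [restricted_basis], and dividing by the gcd makes it primitive.
    Conversely a primitive multiple of the restriction of [beta] equals, up to
    sign, the vector obtained from [beta] in this way; the sign is absorbed by
    replacing [beta] with [- beta]. *)
Lemma restricted_rootsE : (forall alpha, Phi alpha -> Phi (- alpha)) ->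
  restricted_roots Phi X (range f) (f @` [set` ~: Q]) = primitive_multiples S.
Proof.
move=> PhiN.
have fi := dual_inj fe; have feX := restrict_dual_families.
have Smem := restricted_basis_mem; have Scomb := restrict_combinations.
have diff : range f `\` f @` [set` ~: Q] = f @` [set` Q].
  apply/seteqP; split => [_ [[i _ <-] iQ]|_ [i iQ <-]].
    exists i => //=; apply: contrapT => niQ; apply: iQ; exists i => //=.
    by rewrite inE; apply/negP.
  by split; [exists i|move=> [j jQ /fi ji]; move: jQ; rewrite ji /= inE iQ].
(* The gcd and the reduced vector of the definition, indexed by [Q]. *)
pose d (b : 'Hom(V, R^o) -> int) := \big[gcdn/0%N]_x `|b (f (val (x : {i | i \in Q})))|%N.
pose red (b : 'Hom(V, R^o) -> int) := \sum_x restricted_basis x *~ (b (f (val x)) %/ d b)%Z.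
have -> : restricted_roots Phi X (range f) (f @` [set` ~: Q]) =
  [set gamma | exists beta b, [/\ Phi beta, ~ real_span (f @` [set` ~: Q]) beta,
     beta = \sum_i f i *~ b (f i) & gamma = red b]].
  have redE b : \sum_(alpha \in f @` [set` Q]) restrict_form X alpha *~
      (b alpha %/ (\big[gcdn/0%N]_(alpha \in f @` [set` Q]) `|b alpha|%N)%:Z)%Z
      = red b.
    have -> : \big[gcdn/0%N]_(alpha \in f @` [set` Q]) `|b alpha|%N = d b.
      rewrite fsbig_image_finType//.
      exact: (big_sub Q (fun i => `|b (f i)|%N)).
    transitivity (\sum_(i in Q) restrict_form X (f i) *~ (b (f i) %/ d b)%Z).
      exact: fsbig_image_finType.
    exact: (big_sub Q (fun i => restrict_form X (f i) *~ (b (f i) %/ d b)%Z)).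
  apply/seteqP; split => gamma [beta [b]].
    rewrite /= diff redE fsbig_range// => -[Pb nb bE gE].
    by exists beta, b.
  move=> [Pb nb bE gE]; exists beta, b; rewrite /= diff redE fsbig_range//.
have span_restrict b : (real_span (f @` [set` ~: Q]) (\sum_i f i *~ b (f i))) <->
    forall x : {i | i \in Q}, b (f (val x)) = 0.
  split=> [[c E] x|b0].
    move/(congr1 (fun a : 'Hom(V, R^o) => a (e (val x)))): E.
    rewrite (combination_coord fe) fsbig_image_finType// sum_lfunE big1.
      by move/eqP; rewrite intr_eq0 => /eqP.
    move=> i; rewrite inE => iQ; rewrite scale_lfunE fe.1.
    case: eqP iQ => [->|_ _]; first by rewrite (valP x).
    by rewrite scaler0.
  exists (fun a => (b a)%:~R); rewrite fsbig_image_finType//.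
  rewrite [LHS](bigID (mem Q)) /= [X in X + _]big1 ?add0r => [|i iQ]; last first.
    by have /= -> := b0 (exist _ i iQ); rewrite mulr0z.
  by apply: eq_big => [i|i _]; rewrite ?inE// scaler_int.
have red_primitive beta b : Phi beta -> ~ real_span (f @` [set` ~: Q]) beta ->
    beta = \sum_i f i *~ b (f i) ->
    primitive_multiples S (red b) /\
    exists c : R, red b = c *: restrict_form X beta.
  move=> Pb nb bE.
  have [|d0 pr rE] := primitive_gcd feX Smem Scomb (m := fun x => b (f (val x))).
    apply: contrapT => no; apply: nb; rewrite bE; apply/span_restrict => x.
    by apply/eqP; apply: contraPT no => bx; apply; exists x.
  have E : red b = (d b)%:R^-1 *: restrict_form X beta.
    rewrite bE (restrict_combination (b \o f)).
    apply: (canRL (scalerK _)); first by rewrite pnatr_eq0.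
    by rewrite [RHS]rE.
  split; last by exists (d b)%:R^-1.
  split => //; exists (restrict_form X beta), (d b)%:R^-1; split=> //.
  by exists beta.
apply/seteqP; split => [gamma [beta [b [Pb nb bE ->]]]|gamma pg].
  by have [] := red_primitive _ _ Pb nb bE.
have [pp [_ [c [[beta Pb <-] gE]]]] := pg.
have [b bE] : exists b, beta = \sum_i f i *~ b (f i).
  have : integer_span (range f) beta by rewrite integer_span_range//; exact: Phi_comb.
  by move=> [b ->]; exists b; rewrite fsbig_range.
have nb : ~ real_span (f @` [set` ~: Q]) beta.
  rewrite bE => /span_restrict z; have := primitive_neq0 pp.
  rewrite gE bE (restrict_combination (b \o f)) big1 ?scaler0 ?eqxx// => x _.
  by rewrite /= z mulr0z.
have [pr [c' rE]] := red_primitive _ _ Pb nb bE.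
rewrite gE in pg *; rewrite rE in pr.
have [->|->] := primitive_multiple_unique feX Smem Scomb pr pg.
  by exists beta, b; rewrite -rE.
have bNE : - beta = \sum_i f i *~ - b (f i).
  by rewrite bE -sumrN; apply: eq_bigr => i _; rewrite mulrNz.
exists (- beta), (fun a => - b a); split; [exact: PhiN| |exact: bNE|].
  rewrite bNE => /(span_restrict (fun a => - b a)) z; apply: nb; rewrite bE.
  by apply/span_restrict => x; have /eqP := z x; rewrite oppr_eq0 => /eqP.
rewrite -rE /red -sumrN; apply: eq_bigr => x _; rewrite -mulrNz; congr (_ *~ _).
have -> : d (fun a => - b a) = d b by apply: eq_bigr => y _; rewrite abszN.
have dm : (d b %| b (f (val x)))%Z by rewrite /dvdz /=; exact: (biggcdn_inf x).
have [->|dn0] := eqVneq (d b) 0%N; first by rewrite !divz0 oppr0.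
by rewrite -{2}(divzK dm) -mulNr mulzK.
Qed.

End Coordinates.
End RestrictedForms.

(** * Parabolic restrictions are crystallographic *)

Definition parabolic_roots (R : realType) (V : vectType R)
    (Phi : set 'Hom(V, R^o)) (X : {vspace V}) : set 'Hom(subvs_of X, R^o) :=
  primitive_multiples (restrict_form X @` Phi).
Arguments parabolic_roots {R V} Phi X _.

Section ParabolicRestriction.
Variables (R : realType) (V : vectType R).
Implicit Types (A : set {vspace V}) (Phi : set 'Hom(V, R^o)) (K : set V).
Implicit Types (alpha beta : 'Hom(V, R^o)) (v x y : V) (X : {vspace V}).

(** On the closed cone a root is a combination of the coordinates [f i] with
    coefficients of one sign; where it vanishes, each term vanishes. *)
Lemma closed_cone_root_eq0 (I : finType) (f : I -> 'Hom(V, R^o)) e Phi y beta v :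
  dual_families f e -> same_side Phi y = positive_cone f -> Phi beta ->
  (forall i, 0 <= f i v) -> beta v * beta y = 0 ->
  forall i, f i v != 0 -> beta (e i) * beta y = 0.
Proof.
move=> fe KE Pb v0 + i fv.
rewrite {1}[v](vector_expand fe) linear_sum mulr_suml => /eqP.
have E j : beta ((f j v : R) *: e j) * beta y = (f j v : R) * (beta (e j) * beta y).
  by rewrite linearZ mulrA.
rewrite psumr_eq0 => [|j _]; last first.
  by rewrite E; apply: mulr_ge0 => //; exact: (generator_root_ge0 j fe KE Pb).
move=> /allP/(_ i (mem_index_enum _)) /=.
by rewrite E mulf_eq0 (negbTE fv) => /eqP.
Qed.

Lemma closed_cone_root_ge0 (I : finType) (f : I -> 'Hom(V, R^o)) e Phi y beta v :
  dual_families f e -> same_side Phi y = positive_cone f -> Phi beta ->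
  (forall i, 0 <= f i v) -> 0 <= beta v * beta y.
Proof.
move=> fe KE Pb v0; rewrite [v](vector_expand fe) linear_sum mulr_suml.
apply: sumr_ge0 => j _; rewrite linearZ -mulrA; apply: mulr_ge0 => //.
exact: (generator_root_ge0 j fe KE Pb).
Qed.

Lemma memv_bigcap (s : seq {vspace V}) v :
  (v \in (\bigcap_(H <- s) H)%VS) = all (fun H : {vspace V} => v \in H) s.
Proof.
elim: s => [|H s IH]; first by rewrite big_nil memvf.
by rewrite big_cons memv_cap IH.
Qed.

(** Some chamber has the generic point [x] of [X] in its closure, with [X] as the
    support of the face of [x]: the simple roots that vanish at [x] vanish on [X]
    because [x] is generic, and they cut out [X] because a root that contains [X]
    in its kernel vanishes at [x], so it involves no other simple root. *)
Lemma adjacent_chamber A Phi X x :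
  simplicial A -> root_set A Phi -> intersection_lattice A X -> x \in X ->
  (forall alpha, Phi alpha -> alpha x = 0 -> (X <= lker alpha)%VS) ->
  exists y (f : 'I_(\dim {:V}) -> 'Hom(V, R^o)) e (Q : {set 'I_(\dim {:V})}),
    [/\ forall alpha, Phi alpha -> alpha y != 0,
        simple_system Phi (same_side Phi y) f e,
        forall v, v \in X <-> forall i, i \notin Q -> f i v = 0 &
        forall i, i \in Q -> 0 < f i x].
Proof.
move=> simA rs [s sA XE] xX gx; have [[/finite_seqP [l lE] defA _] [arr _]] := (rs, simA).
have mem_l alpha : Phi alpha <-> alpha \in l by rewrite lE.
have [y _ yP] : exists2 y, y \in fullv & {in l, forall alpha,
    alpha y != 0 /\ (alpha x != 0 -> 0 < alpha y * alpha x)}.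
  apply: generic_vector; first exact: memvf.
  move=> alpha /mem_l/(root_neq0 arr rs) a0.
  have [v av] : exists v, alpha v != (0 : 'Hom(V, R^o)) v by exact/lfunPn.
  by exists v; rewrite ?memvf//; move: av; rewrite zero_lfunE.
have y0 alpha : Phi alpha -> alpha y != 0 by move=> /mem_l/yP[].
have chK : chamber A (same_side Phi y) by apply/(chamberP _ defA); exists y.
have [f [e [fe Pf KE]]] := chamber_simple_system simA rs chK.
have fy i : 0 < f i y.
  have : same_side Phi y y.
    by move=> alpha Pa; rewrite -expr2 exprn_even_gt0//= y0.
  by rewrite KE.
have fx i : f i x != 0 -> 0 < f i x.
  move=> fx0; have [_ /(_ fx0)] := yP _ ((mem_l _).1 (Pf i)).
  by rewrite pmulr_rgt0.
have fx_ge0 i : 0 <= f i x.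
  by have [->|/fx/ltW] := eqVneq (f i x) 0.
exists y, f, e, [set i | f i x != 0]%SET; split => //; last first.
  by move=> i; rewrite inE => /fx.
move=> v; split=> [vX i|v0].
  rewrite inE negbK => /eqP/(gx _ (Pf i))/subvP/(_ v vX).
  by rewrite memv_ker => /eqP.
have sub H : H \in s -> v \in H.
  move=> Hs; have : A H by exact: sA.
  rewrite defA => -[beta Pb HE]; rewrite -HE memv_ker.
  have bx : beta x = 0.
    apply/eqP; rewrite -memv_ker HE.
    by move: xX; rewrite XE memv_bigcap => /allP; apply.
  have be i : f i x != 0 -> beta (e i) = 0.
    move=> /(closed_cone_root_eq0 fe KE Pb fx_ge0); rewrite bx mul0r => /(_ erefl)/eqP.
    by rewrite mulf_eq0 (negbTE (y0 _ Pb)) orbF => /eqP.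
  rewrite [v](vector_expand fe) linear_sum big1// => i _.
  have [fi0|fi0] := eqVneq (f i x) 0.
    by rewrite v0 ?scale0r ?linear0// inE fi0 eqxx.
  by rewrite linearZ /= be ?scaler0.
by rewrite XE memv_bigcap; apply/allP.
Qed.

Lemma crystallographic_combinations A Phi K (I : finType)
    (f : I -> 'Hom(V, R^o)) e :
  crystallographic A Phi -> chamber A K -> simple_system Phi K f e ->
  Phi `<=` integer_combinations f.
Proof.
move=> [_ rs int_span] chK fs; rewrite -integer_span_range; last first.
  by case: fs => /dual_inj.
by rewrite -(simple_rootsE rs fs); exact: int_span.
Qed.

(** A root that is not zero on [X] has a nonzero coordinate in [Q], so on the
    points of [X] where the restricted simple roots are positive it has the same
    strict sign as on the chamber of [y].  Hence these points lie on the same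
    side of every restricted hyperplane. *)
Lemma face_simple_system Phi X x y (I : finType) (f : I -> 'Hom(V, R^o)) e
    (Q : {set I}) (xX : x \in X) :
  simple_system Phi (same_side Phi y) f e ->
  (forall alpha, Phi alpha -> alpha y != 0) ->
  Phi `<=` integer_combinations f ->
  (forall v, v \in X <-> forall i, i \notin Q -> f i v = 0) ->
  (forall i, i \in Q -> 0 < f i x) ->
  simple_system (parabolic_roots Phi X)
    (same_side (parabolic_roots Phi X) (vsproj X x))
    (restricted_basis X f (Q := Q)) (restricted_dual X e (Q := Q)).
Proof.
move=> [fe Pf KE] y0 comb XE fx.
have feX := restrict_dual_families fe XE.
have Smem := restricted_basis_mem X (Q := Q) Pf.
have Scomb := restrict_combinations XE comb.
have basisP := primitive_multiples_basis feX Smem Scomb.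
split=> //; apply/seteqP; split=> v.
  move=> vx i; have := vx _ (basisP i).
  by rewrite pmulr_lgt0// restrict_formE vsprojK// fx// (valP i).
move=> v0 gamma [pg [_ [c [[beta Pb <-] gE]]]].
have side w : (forall i : {i : I | i \in Q}, 0 < restricted_basis X f i w) ->
    0 < restrict_form X beta w * beta y.
  move=> w0; rewrite restrict_formE lt0r.
  have w_ge0 i : 0 <= f i (vsval w).
    have [iQ|/((XE _).1 (subvsP w)) ->//] := boolP (i \in Q).
    by have := w0 (exist _ i iQ); rewrite restrict_formE => /ltW.
  rewrite (closed_cone_root_ge0 fe KE Pb)// andbT.
  apply/eqP => /(closed_cone_root_eq0 fe KE Pb w_ge0) be.
  have := primitive_neq0 pg; rewrite gE scaler_eq0 negb_or => /andP[_ /negP].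
  apply; rewrite [restrict_form X beta](form_expand feX) big1// => i _.
  rewrite restrict_formE (restricted_dualK fe XE).
  have fw : f (val i) (vsval w) != 0.
    by have := w0 i; rewrite restrict_formE => /gt_eqF ->.
  have /eqP := be _ fw; rewrite mulf_eq0 (negbTE (y0 _ Pb)) orbF => /eqP ->.
  by rewrite scale0r.
have c0 : c != 0.
  by have := primitive_neq0 pg; rewrite gE scaler_eq0 negb_or => /andP[].
have vy := side _ v0.
have xy : 0 < restrict_form X beta (vsproj X x) * beta y.
  by apply: side => i; rewrite restrict_formE vsprojK// fx// (valP i).
rewrite gE !scale_lfunE.
move: vy xy; set a : R := restrict_form X beta v.
set b : R := restrict_form X beta _; set z : R := beta y => vy xy.
have z0 : 0 < z ^+ 2 by rewrite exprn_even_gt0//= y0.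
have cc : 0 < c ^+ 2 by rewrite exprn_even_gt0.
have := mulr_gt0 cc (mulr_gt0 vy xy).
have -> : c ^+ 2 * (a * z * (b * z)) = (c * a) * (c * b) * z ^+ 2.
  by ring.
by rewrite pmulr_lgt0.
Qed.

Lemma face_of_parabolic A Phi X x :
  crystallographic A Phi -> intersection_lattice A X -> x \in X ->
  (forall alpha, Phi alpha -> alpha x = 0 -> (X <= lker alpha)%VS) ->
  exists (I : finType) (f : I -> 'Hom(subvs_of X, R^o)) e,
    [/\ simple_system (parabolic_roots Phi X)
          (same_side (parabolic_roots Phi X) (vsproj X x)) f e,
        (forall i, (restrict_form X @` Phi) (f i)),
        restrict_form X @` Phi `<=` integer_combinations f &
        restricted_root_system A Phi X (parabolic_roots Phi X)].
Proof.
move=> cr latX xX gx; have [simA rs _] := cr; have [_ defA _] := rs.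
have [y [f [e [Q [y0 fs XE fx]]]]] := adjacent_chamber simA rs latX xX gx.
have chK : chamber A (same_side Phi y) by apply/(chamberP _ defA); exists y.
have comb := crystallographic_combinations cr chK fs.
have [fe Pf KE] := fs.
exists {i | i \in Q}, (restricted_basis X f (Q := Q)), (restricted_dual X e (Q := Q)).
split.
- exact: (face_simple_system xX fs y0 comb XE fx).
- exact: (restricted_basis_mem X Pf).
- exact: (restrict_combinations XE comb).
have sr := simple_rootsE rs fs.
exists (same_side Phi y), (f @` [set` (~: Q)%SET]); split => //.
- by rewrite sr => _ [i _ <-]; exists i.
- apply/seteqP; split => v /=.
    by move=> /XE vX _ [i iQ <-]; apply: vX; move: iQ; rewrite /= inE.
  by move=> vX; apply/XE => i iQ; apply: vX; exists i => //=; rewrite inE.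
rewrite sr (restricted_rootsE fe XE Pf comb)//.
by move=> alpha; exact: root_opp rs.
Qed.

(** Used with [Y = X] to find a first chamber of the restriction to [X], and with
    [Y] the fixed space of an automorphism to find a chamber that it preserves. *)
Lemma relative_generic_vector A Phi X Y : root_set A Phi -> (Y <= X)%VS ->
  (forall alpha, Phi alpha -> (Y <= lker alpha)%VS -> (X <= lker alpha)%VS) ->
  exists2 x, x \in Y &
    forall alpha, Phi alpha -> alpha x = 0 -> (X <= lker alpha)%VS.
Proof.
move=> [/finite_seqP [l lE] _ _] YX YPhi.
have mem_l alpha : Phi alpha <-> alpha \in l by rewrite lE.
have [||x xY x0] := @generic_vector _ _ Y
    [seq alpha <- l | ~~ (X <= lker alpha)%VS] 0.
- exact: mem0v.
- move=> alpha; rewrite mem_filter => /andP[nX /mem_l Pa].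
  have : ~~ (Y <= lker alpha)%VS by apply: contra nX => /YPhi; exact.
  by case/subvPn => v vY; rewrite memv_ker => av; exists v.
exists x => // alpha Pa ax; apply: contraT => nX.
have [] := x0 alpha; first by rewrite mem_filter nX; exact/mem_l.
by rewrite ax eqxx.
Qed.

Lemma restriction_arrangement A Phi X : root_set A Phi ->
  finite_set A -> arrangement (restriction A X).
Proof.
move=> [_ defA _] fA; split.
  by apply: finite_image; apply: sub_finite_set fA => H [].
rewrite (restriction_kernels X defA) => _ [alpha [_ a0] <-].
exact/kernel_hyperplane.
Qed.

(** Every chamber of the restriction is the chamber of a point of [X], and
    [face_of_parabolic] equips it with simple roots that span the lattice of the
    restricted roots.  That the restricted roots form a root system follows from
    any one of these bases. *)
Lemma parabolic_crystallographic A Phi X :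
  crystallographic A Phi -> intersection_lattice A X ->
  crystallographic (restriction A X) (parabolic_roots Phi X) /\
  restricted_root_system A Phi X (parabolic_roots Phi X).
Proof.
move=> cr latX; have [[[fA dA] sA] rs _] := cr; have [fPhi defA _] := rs.
have [x0 x0X gx0] := relative_generic_vector rs (subvv X) (fun _ _ => id).
have [I [f [e [[fe _ _] Sf comb rrs]]]] := face_of_parabolic cr latX x0X gx0.
split=> //.
have rsX : root_set (restriction A X) (parabolic_roots Phi X).
  rewrite (restriction_kernels X defA).
  by apply: (primitive_multiples_root_set fe Sf comb); exact: finite_image.
have [_ defAX _] := rsX.
have chX L : chamber (restriction A X) L ->
    exists (I : finType) (f : I -> 'Hom(subvs_of X, R^o)) e,
    [/\ simple_system (parabolic_roots Phi X) L f e,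
        (forall i, (restrict_form X @` Phi) (f i)) &
        restrict_form X @` Phi `<=` integer_combinations f].
  move=> /(chamberP _ defAX) [x xP ->].
  have [||J [h [k [hk Sh combh _]]]] := @face_of_parabolic A Phi X (vsval x) cr latX.
  - exact: subvsP.
  - move=> alpha Pa ax; rewrite -restrict_form_eq0; apply: contraT => a0.
    have Sa : (restrict_form X @` Phi) (restrict_form X alpha) by exists alpha.
    have [c [gamma [_ /xP + gE]]] := exists_primitive_multiple fe Sf comb Sa a0.
    by rewrite gE scale_lfunE restrict_formE ax scaler0 eqxx.
  by rewrite vsvalK in hk; exists J, h, k.
split=> //.
  split=> [|L /chX [J [h [k [[hk _ ->] _ _]]]]]; first exact: restriction_arrangement rs fA.
  by have [b [? [gb _ _]]] := generators_positive_cone hk; exists b.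
move=> L /chX [J [h [k [hs Sh combh]]]]; have [hk _ _] := hs.
rewrite (simple_rootsE rsX hs) integer_span_range; last exact: dual_inj hk.
by rewrite -(generated_combinations Sh combh) => gamma [[]].
Qed.

End ParabolicRestriction.

(** * Involutive automorphisms *)

Section Automorphisms.
Variables (R : realType) (V : vectType R).
Implicit Types (A : set {vspace V}) (Phi : set 'Hom(V, R^o)) (K : set V).
Implicit Types (alpha beta : 'Hom(V, R^o)) (v x y : V) (X : {vspace V}).
Variable phi : 'End(V).
Hypothesis phi2 : (phi \o phi)%VF = \1%VF.

Lemma involutionK : involutive phi.
Proof. by move=> v; rewrite -comp_lfunE phi2 id_lfunE. Qed.

Lemma involution_lker : lker phi = 0%VS.
Proof. by apply/eqP/lker0P; exact: can_inj involutionK. Qed.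

Lemma involution_inv : (phi^-1)%VF = phi.
Proof.
apply/lfunP => v; rewrite -{1}[v]involutionK lker0_lfunK//.
by rewrite involution_lker.
Qed.

Lemma involution_action alpha : form_action phi alpha = (alpha \o phi)%VF.
Proof. by rewrite /form_action involution_inv. Qed.

Lemma involution_formK alpha : ((alpha \o phi) \o phi)%VF = alpha.
Proof. by rewrite -comp_lfunA phi2 comp_lfun1r. Qed.

Lemma involution_form_image Phi :
  (forall alpha, Phi alpha -> Phi (alpha \o phi)%VF) ->
  [set form_action phi alpha | alpha in Phi] = Phi.
Proof.
move=> Pphi; apply/seteqP; split=> [_ [alpha Pa <-]|alpha Pa].
  by rewrite involution_action; exact: Pphi.
exists (alpha \o phi)%VF; first exact: Pphi.
by rewrite involution_action involution_formK.
Qed.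

Lemma involution_img_lker alpha : (phi @: lker alpha)%VS = lker (alpha \o phi)%VF.
Proof.
apply/vspaceP => v; rewrite memv_ker comp_lfunE.
apply/memv_imgP/eqP => [[w + ->]|av].
  by rewrite memv_ker involutionK => /eqP.
by exists (phi v); rewrite ?involutionK// memv_ker av.
Qed.

Lemma involution_arrangement_action A Phi : root_set A Phi ->
  (forall alpha, Phi alpha -> Phi (alpha \o phi)%VF) ->
  arrangement_action phi A Phi.
Proof.
move=> [_ defA _] Pphi; split.
- exact: involution_lker.
- rewrite defA; apply/seteqP; split=> [_ [_ [alpha Pa <-] <-]|_ [alpha Pa <-]].
    by exists (alpha \o phi)%VF; [exact: Pphi|rewrite involution_img_lker].
  exists (lker (alpha \o phi)%VF); first by exists (alpha \o phi)%VF => //; exact: Pphi.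
  by rewrite involution_img_lker involution_formK.
exact: involution_form_image.
Qed.

(** The chamber of a fixed point is invariant, so composing its simple roots with
    [phi] gives another simple system of the same chamber; by [simple_rootsE] the
    two sets of simple roots agree. *)
Lemma fixed_chamber_permutation A Phi x : simplicial A -> root_set A Phi ->
  (forall alpha, Phi alpha -> Phi (alpha \o phi)%VF) ->
  (forall alpha, Phi alpha -> alpha x != 0) -> phi x = x ->
  permutation_action phi A Phi (same_side Phi x).
Proof.
move=> simA rs Pphi x0 phix; have [_ defA _] := rs.
have chK : chamber A (same_side Phi x) by apply/(chamberP _ defA); exists x.
split=> //; first exact: involution_arrangement_action.
have [f [e fs]] := chamber_simple_system simA rs chK; have [fe Pf KE] := fs.
have K_phi v : same_side Phi x v -> same_side Phi x (phi v).
  by move=> xv alpha Pa; have := xv _ (Pphi _ Pa); rewrite !comp_lfunE phix.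
have fs' : simple_system Phi (same_side Phi x) (fun i => f i \o phi)%VF (phi \o e).
  split=> [|i|]; last 2 first.
  - exact: Pphi.
  - apply/seteqP; split=> v.
      by move=> /K_phi; rewrite KE => H i; rewrite comp_lfunE.
    move=> v0; rewrite -[v]involutionK; apply: K_phi; rewrite KE => i.
    by have := v0 i; rewrite comp_lfunE.
  split=> [i j|v v0]; first by rewrite comp_lfunE /= involutionK fe.1.
  rewrite -[v]involutionK [phi v]fe.2 ?linear0// => i.
  by have := v0 i; rewrite comp_lfunE.
rewrite {1}(simple_rootsE rs fs) (simple_rootsE rs fs').
apply/seteqP; split=> [_ [_ [i _ <-] <-]|_ [i _ <-]].
  by exists i => //; rewrite involution_action.
by exists (f i); [exists i|rewrite involution_action].
Qed.

End Automorphisms.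

Section RestrictedAutomorphism.
Variables (R : realType) (V : vectType R).
Implicit Types (A : set {vspace V}) (Phi : set 'Hom(V, R^o)).
Variables (g : 'End(V)) (X : {vspace V}).
Hypothesis gX : (g @: X)%VS = X.

Lemma restrict_endE (v : subvs_of X) : vsval (restrict_end g X v) = g (vsval v).
Proof.
rewrite !comp_lfunE inclusionE lfunE /= vsprojK//.
by rewrite -{2}gX memv_img// subvsP.
Qed.

Lemma restrict_end_involution : (g \o g)%VF = \1%VF ->
  (restrict_end g X \o restrict_end g X)%VF = \1%VF.
Proof.
move=> g2; apply/lfunP => v; apply: subvs_inj.
by rewrite comp_lfunE !restrict_endE (involutionK g2) id_lfunE.
Qed.

Lemma restrict_form_comp (alpha : 'Hom(V, R^o)) :
  (restrict_form X alpha \o restrict_end g X)%VF = restrict_form X (alpha \o g)%VF.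
Proof.
by apply/lfunP => v; rewrite comp_lfunE !restrict_formE restrict_endE comp_lfunE.
Qed.

Lemma fixedSpace_restrict_end : (fixedSpace g <= X)%VS ->
  (inclusion X @: fixedSpace (restrict_end g X))%VS = fixedSpace g.
Proof.
move=> fX; apply/vspaceP => v; apply/memv_imgP/fixedSpaceP => [[w + ->]|gv].
  by move=> /fixedSpaceP gw; rewrite inclusionE -restrict_endE gw.
have vX : v \in X by apply: (subvP fX); exact/fixedSpaceP.
exists (vsproj X v); last by rewrite inclusionE vsprojK.
by apply/fixedSpaceP/subvs_inj; rewrite restrict_endE !vsprojK.
Qed.

End RestrictedAutomorphism.

(** * Iterated restrictions *)

Lemma in_ambient_restriction (R : realType) (V : vectType R)
    (A : set {vspace V}) (X : {vspace V}) :
  in_ambient (restriction A X) =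
  [set (X :&: H)%VS | H in [set H | A H /\ ~~ (X <= H)%VS]].
Proof.
have imgE H : (inclusion X @: (inclusion X @^-1: H))%VS = (X :&: H)%VS.
  apply/vspaceP => v; rewrite memv_cap; apply/memv_imgP/andP => [[w + ->]|[vX vH]].
    by rewrite -memv_preim inclusionE => wH; rewrite subvsP.
  exists (vsproj X v); last by rewrite inclusionE vsprojK.
  by rewrite -memv_preim inclusionE vsprojK.
rewrite /in_ambient /restriction image_comp.
by apply/seteqP; split=> [_ [H HA <-]|_ [H HA <-]]; exists H => //=.
Qed.

(** A hyperplane that contains [X1] also contains the smaller space [X], so
    restricting to [X1] first discards no hyperplane that matters for [X]. *)
Lemma in_ambient_restriction_tower (R : realType) (V : vectType R)
    (A : set {vspace V}) (X1 X : {vspace V}) (X' : {vspace subvs_of X1}) :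
  (inclusion X1 @: X')%VS = X ->
  in_ambient (in_ambient (restriction (restriction A X1) X')) =
  in_ambient (restriction A X).
Proof.
move=> <-; rewrite !in_ambient_restriction /in_ambient.
have imgE H : (inclusion X1 @: (X' :&: (inclusion X1 @^-1: H)))%VS
    = (inclusion X1 @: X' :&: H)%VS.
  apply/vspaceP => v; rewrite memv_cap.
  apply/memv_imgP/andP => [[w + ->]|[/memv_imgP[w wX' ->] vH]].
    by rewrite memv_cap -memv_preim => /andP[wX' wH]; rewrite memv_img.
  by exists w; rewrite ?memv_cap ?wX' -?memv_preim.
have subE H : (X' <= inclusion X1 @^-1: H)%VS = (inclusion X1 @: X' <= H)%VS.
  apply/subvP/subvP => sub v; first by case/memv_imgP => w /sub + ->; rewrite -memv_preim.
  by move=> vX'; rewrite -memv_preim sub// memv_img.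
apply/seteqP; split=> [_ [_ [_ [[H [AH nX1] <-] nX'] <-] <-]|_ [H [AH nX] <-]].
  by exists H; [split; rewrite // -subE|rewrite imgE].
exists (X' :&: (inclusion X1 @^-1: H))%VS; last by rewrite imgE.
exists (inclusion X1 @^-1: H)%VS => //; split; last by rewrite subE.
exists H => //; split=> //; apply: contra nX; apply: subv_trans.
apply/subvP => v /memv_imgP[w _ ->]; rewrite inclusionE; exact: subvsP.
Qed.

(** * The two-step decomposition *)

Theorem lemma3p9 (R : realType) (r : nat)
  (A : set {vspace 'rV[R]_r}) (Phi : set 'Hom('rV[R]_r, R^o))
  (g : 'End('rV[R]_r))
  (hcryst : crystallographic A Phi)
  (hinv : (g \o g)%VF = \1%VF)
  (hg : arrangement_action g A Phi) :
  let X := fixedSpace g in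
  exists X1 : {vspace 'rV[R]_r},
    let A1 := restriction A X1 in
    let g1 := restrict_end g X1 in
    let X' := fixedSpace g1 in
    [/\ intersection_lattice A X1,
        (g @: X1)%VS = X1,
        (X <= X1)%VS,
        exists (Phi1 : set 'Hom(subvs_of X1, R^o)) (K2 : set (subvs_of X1)),
          [/\ restricted_root_system A Phi X1 Phi1,
              crystallographic A1 Phi1 &
              permutation_action g1 A1 Phi1 K2] &
        (inclusion X1 @: X')%VS = X /\
        in_ambient (in_ambient (restriction A1 X'))
          = in_ambient (restriction A X)].
Proof.
have [simA rs _] := hcryst; have [[fA _] _] := simA; have [_ defA _] := rs.
have [_ _ gPhi] := hg.
have Phig alpha : Phi alpha -> Phi (alpha \o g)%VF.
  move=> Pa; rewrite -gPhi -(involution_action hinv); by exists alpha.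
have [s sE] := (finite_seqP _).1 fA.
move=> X.
pose t := [seq H <- s | (X <= H)%VS].
pose X1 := (\bigcap_(H <- t) H)%VS.
have X1P v : v \in X1 <->
    forall alpha, Phi alpha -> (X <= lker alpha)%VS -> alpha v = 0.
  rewrite memv_bigcap; split=> [/allP tv alpha Pa Xa|av].
    apply/eqP; rewrite -memv_ker; apply: tv; rewrite mem_filter Xa /=.
    have : A (lker alpha) by rewrite defA; exists alpha.
    by rewrite sE.
  apply/allP => H; rewrite mem_filter => /andP[XH sH].
  have : A H by rewrite sE.
  rewrite defA => -[alpha Pa HE]; move: XH; rewrite -HE memv_ker => Xa.
  by apply/eqP/av.
have XX1 : (X <= X1)%VS.
  apply/subvP => v vX; apply/X1P => alpha _ /subvP/(_ v vX).
  by rewrite memv_ker => /eqP.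
(* A root whose kernel contains X is sent by g to another such root. *)
have gX1 : (g @: X1)%VS = X1.
  have gv v : v \in X1 -> g v \in X1.
    move=> /X1P av; apply/X1P => alpha Pa Xa; rewrite -comp_lfunE; apply: av.
      exact: Phig.
    apply/subvP => w wX; have /fixedSpaceP gw := wX.
    by rewrite memv_ker comp_lfunE gw -memv_ker (subvP Xa).
  apply/vspaceP => v; apply/memv_imgP/idP => [[w wX1 ->]|vX1]; first exact: gv.
  by exists (g v); [exact: gv|rewrite (involutionK hinv)].
have latX1 : intersection_lattice A X1.
  exists t => // H /=; rewrite mem_filter => /andP[_ sH]; by rewrite sE.
have [x xX gx] : exists2 x, x \in X &
    forall alpha, Phi alpha -> alpha x = 0 -> (X1 <= lker alpha)%VS.
  apply: relative_generic_vector rs XX1 _ => alpha Pa Xa.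
  by apply/subvP => v /X1P/(_ _ Pa Xa) av; rewrite memv_ker av.
have xX1 : x \in X1 by apply: (subvP XX1).
have [cr1 rrs] := parabolic_crystallographic hcryst latX1.
have g1_2 := restrict_end_involution gX1 hinv.
have [simA1 rs1 _] := cr1.
exists X1; split => //; last first.
  have E := fixedSpace_restrict_end gX1 XX1.
  by split; [exact: E|exact: in_ambient_restriction_tower].
exists (parabolic_roots Phi X1), (same_side (parabolic_roots Phi X1) (vsproj X1 x)).
split=> //; apply: fixed_chamber_permutation => //.
- apply: primitive_multiples_comp => // _ [alpha Pa <-].
  by exists (alpha \o g)%VF; [exact: Phig|rewrite restrict_form_comp].
- move=> gamma [pg [_ [c [[alpha Pa <-] gE]]]].
  have := primitive_neq0 pg; rewrite gE scaler_eq0 negb_or => /andP[c0 a0].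
  rewrite scale_lfunE restrict_formE vsprojK// scaler_eq0 (negbTE c0) /=.
  by apply: contra a0 => /eqP/(gx _ Pa); rewrite restrict_form_eq0.
apply: subvs_inj; rewrite (restrict_endE gX1) vsprojK//.
by apply/fixedSpaceP.
Qed.
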